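(* Let $f:\mathbb{R}^n\to\mathbb{R}$ be differentiable and bounded from below, let $c$ be a constant with $f(\theta)+c>0$ for all $\theta\in\mathbb{R}^n$, and put $g(\theta)=\sqrt{f(\theta)+c}$. Let $\eta>0$, $\theta_0\in\mathbb{R}^n$, and let $(\theta_k,r_k)$ be generated by the global AEGD iteration, with effective step sizes $\eta_k=\eta\, r_{k+1}/g(\theta_k)$. Then for every $k\ge 1$, $$\frac1k\sum_{j=0}^{k-1}\|\nabla g(\theta_j)\|^2\le \frac{\sqrt{f(\theta_0)+c}}{2\eta k r_k}.$$ Moreover: (i) Suppose $f$ is PL (with constant $\mu>0$) and $L$-smooth with a minimizer $\theta^*$, and let $k_0\ge 0$. If $\max_{k_0\le j<k}\eta_j\le 1/L$ for all $k>k_0$, then $\{\theta_k\}$ is convergent and $$\sum_{k=k_0}^\infty\|\theta_{k+1}-\theta_k\|\le \frac{4}{\sqrt{2\mu}}\sqrt{f(\theta_{k_0})-f(\theta^* )}.$$ For any $k>k_0$ with $\max_{k_0\le j<k}\eta_j\le 1/L$, $$f(\theta_k)-f(\theta^* )\le e^{-c_0(k-k_0)r_k}\,(f(\theta_{k_0})-f(\theta^* )),\qquad c_0:=\frac{\mu\eta}{\sqrt{f(\theta_{k_0})+c}}.$$ (ii) Suppose $f$ is convex and $L$-smooth with a global minimizer $\theta^*$. If $\max_{k_0\le j<k}\eta_j\le 1/L$ for some $k_0\ge 0$ and $k>k_0$, then $$f(\theta_k)-f(\theta^* )\le \frac{c_1\|\theta_{k_0}-\theta^*\|^2}{2(k-k_0)r_k},\qquad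 c_1:=\frac{\sqrt{f(\theta_{k_0})+c}}{\eta}.$$ (iii) Suppose $f$ is $\alpha$-strongly convex and $L$-smooth with the global minimizer $\theta^*$. If $\max_{k_0\le j<k}\eta_j\le \frac{2}{\alpha+L}$ for some $k_0\ge 0$ and $k>k_0$, then $$\|\theta_k-\theta^*\|\le e^{-c_2(k-k_0)r_k}\|\theta_{k_0}-\theta^*\|,\qquad c_2:=\frac{\alpha\eta}{\sqrt{f(\theta_{k_0})+c}}.$$
   Context: $\|\cdot\|$ denotes the $\ell_2$-norm (of vectors and matrices). Global AEGD: $r_0=\sqrt{f(\theta_0)+c}$ and, for $k=0,1,2,\dots$, $$r_{k+1}=\frac{r_k}{1+2\eta\|\nabla g(\theta_k)\|^2},\qquad \theta_{k+1}=\theta_k-2\eta\, r_{k+1}\nabla g(\theta_k).$$ Equivalently $\theta_{k+1}=\theta_k-\eta_k\nabla f(\theta_k)$ with $\eta_k:=\eta\, r_{k+1}/g(\theta_k)$. $f$ is $L$-smooth if $\|\nabla^2 f(u)\|\le L$ for all $u\in\mathbb{R}^n$ (with $L>0$). $f$ is $\alpha$-strongly convex if $f(u)\ge f(v)+\langle\nabla f(v),u-v\rangle+\frac{\alpha}{2}\|u-v\|^2$ for all $u,v$ (with $\alpha>0$). $f$ is PL (Polyak–Łojasiewicz) if the set of minimizers of $f$ is nonempty and there is $\mu>0$ such that $\frac12\|\nabla f(\theta)\|^2\ge\mu(f(\theta)-f^* )$ for all $\theta$, where $f^*=\min f$. *)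

(* Defs.v *)
From HB Require Import structures.
From mathcomp Require Import all_boot all_order all_algebra.
From mathcomp Require Import all_classical all_reals all_analysis.

Set Implicit Arguments.
Unset Strict Implicit.
Unset Printing Implicit Defensive.

Import Order.TTheory GRing.Theory Num.Theory.
Import numFieldNormedType.Exports.

Local Open Scope classical_set_scope.
Local Open Scope ring_scope.

Section Euclidean.
Variables (R : realType) (n : nat).
Implicit Types (u v : 'rV[R]_n) (A : 'M[R]_n).

Definition dotprod u v : R := \sum_i u 0 i * v 0 i.

(* The norm `|v| of the normedModType 'rV[R]_n is the sup norm; it induces the
   same topology and the same differentials as the Euclidean norm below. *)
Definition l2norm v : R := Num.sqrt (dotprod v v).

(* Operator (spectral) norm. A acts on row vectors on the right, as in 'J;
   A and A^T have the same spectral norm. *)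
Definition mx_l2norm A : R :=
  sup [set l2norm (v *m A) | v in [set v | l2norm v <= 1]].

End Euclidean.

Section FunctionClasses.
Variables (R : realType) (n : nat).
Implicit Types (f : 'rV[R]_n -> R) (x u v : 'rV[R]_n).

Definition gradient f x : 'rV[R]_n := \row_i 'D_(delta_mx 0 i) f x.

(* The (i, j) entry is the i-th partial derivative of the j-th partial
   derivative of f. *)
Definition hessian f x : 'M[R]_n := 'J (gradient f) x.

Definition twice_differentiable f : Prop :=
  (forall x, differentiable f x) /\ (forall x, differentiable (gradient f) x).

(* Differentials are total functions in the library, so the existence of the
   Hessian has to be required explicitly. *)
Definition smooth f (L : R) : Prop :=
  [/\ 0 < L, twice_differentiable f & forall u, mx_l2norm (hessian f u) <= L].

Definition strongly_convex f (alpha : R) : Prop :=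
  0 < alpha /\
  forall u v, f u >= f v + dotprod (gradient f v) (u - v)
                     + alpha / 2 * l2norm (u - v) ^+ 2.

Definition convex f : Prop :=
  convex_function [set: convex_lmodType 'rV[R]_n] f.

Definition minimizer f x : Prop := forall u, f x <= f u.

(* [inf (range f)] is the minimum of f, since f has a minimizer. *)
Definition PL f (mu : R) : Prop :=
  [/\ 0 < mu, exists x, minimizer f x &
      forall x, 1 / 2 * l2norm (gradient f x) ^+ 2 >= mu * (f x - inf (range f))].

End FunctionClasses.

Section AEGD.
Variables (R : realType) (n : nat) (f : 'rV[R]_n -> R) (c eta : R).

Definition sqrt_shift (x : 'rV[R]_n) : R := Num.sqrt (f x + c).

Definition AEGD (theta0 : 'rV[R]_n) (theta : nat -> 'rV[R]_n) (r : nat -> R)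
    : Prop :=
  [/\ theta 0%N = theta0,
      r 0%N = Num.sqrt (f theta0 + c),
      forall k, r k.+1 =
        r k / (1 + 2 * eta * l2norm (gradient sqrt_shift (theta k)) ^+ 2) &
      forall k, theta k.+1 =
        theta k - (2 * eta * r k.+1) *: gradient sqrt_shift (theta k)].

Definition eff_step (theta : nat -> 'rV[R]_n) (r : nat -> R) (k : nat) : R :=
  eta * r k.+1 / sqrt_shift (theta k).

(* Used for k0 < k only: then k0 is in the range and the default value of the
   iterated maximum is one of its members. *)
Definition max_eff_step (theta : nat -> 'rV[R]_n) (r : nat -> R)
    (k0 k : nat) : R :=
  \big[Num.max/eff_step theta r k0]_(k0 <= j < k) eff_step theta r j.

End AEGD.

(* Main.v *)
(* In terms of f the iteration is gradient descent with step sizes eta_j, since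
   grad g = grad f / (2 g).  The recursion for r telescopes:
   2 eta r_(j+1) |grad g(theta_j)|^2 = r_j - r_(j+1), which gives the first
   bound and shows that r is nonincreasing.  As long as eta_j <= 2 / L the
   descent lemma makes f(theta_j) nonincreasing, hence
   eta_j >= eta r_k / sqrt (f(theta_k0) + c) for k0 <= j < k; the three rates
   are the classical ones of gradient descent with this lower bound on the steps.
   For (i) the decrease is compared with sqrt (f - f* ), which also bounds the
   length of the trajectory; for (ii) the squared distance to the minimizer
   telescopes; for (iii) one step contracts the distance by 1 - alpha eta_j. *)
Require Import Defs.
From HB Require Import structures.
From mathcomp Require Import all_boot all_order all_algebra.
From mathcomp Require Import all_classical all_reals all_analysis.
From mathcomp Require Import ring lra.

Set Implicit Arguments.
Unset Strict Implicit.
Unset Printing Implicit Defensive.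

Import Order.TTheory GRing.Theory Num.Theory.
Import numFieldNormedType.Exports.

Local Open Scope classical_set_scope.
Local Open Scope ring_scope.

(** * Euclidean inner product and spectral norm *)

Section EuclideanSpace.
Variables (R : realType) (n : nat).
Implicit Types (u v w : 'rV[R]_n) (A : 'M[R]_n) (a b : R).

Lemma dotprodC u v : dotprod u v = dotprod v u.
Proof. by apply: eq_bigr => i _; rewrite mulrC. Qed.

Lemma dotprodDl u v w : dotprod (u + v) w = dotprod u w + dotprod v w.
Proof.
by rewrite /dotprod -big_split; apply: eq_bigr => i _; rewrite mxE mulrDl.
Qed.

Lemma dotprodZl a u v : dotprod (a *: u) v = a * dotprod u v.
Proof.
by rewrite /dotprod mulr_sumr; apply: eq_bigr => i _; rewrite mxE mulrA.
Qed.

Lemma dotprodDr u v w : dotprod u (v + w) = dotprod u v + dotprod u w.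
Proof. by rewrite dotprodC dotprodDl !(dotprodC u). Qed.

Lemma dotprodZr a u v : dotprod u (a *: v) = a * dotprod u v.
Proof. by rewrite dotprodC dotprodZl dotprodC. Qed.

Lemma dotprodNl u v : dotprod (- u) v = - dotprod u v.
Proof. by rewrite -scaleN1r dotprodZl mulN1r. Qed.

Lemma dotprodNr u v : dotprod u (- v) = - dotprod u v.
Proof. by rewrite dotprodC dotprodNl dotprodC. Qed.

Lemma dotprod0l v : dotprod 0 v = 0.
Proof. by rewrite -(scale0r 0) dotprodZl mul0r. Qed.

Definition dotprodE :=
  (dotprodDl, dotprodDr, dotprodNl, dotprodNr, dotprodZl, dotprodZr).

Lemma dotprod_ge0 v : 0 <= dotprod v v.
Proof. by apply: sumr_ge0 => i _; rewrite -expr2 sqr_ge0. Qed.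

Lemma dotprod_eq0 v : dotprod v v = 0 -> v = 0.
Proof.
move=> /eqP; rewrite psumr_eq0 => [/allP v0|i _]; last first.
  by rewrite -expr2 sqr_ge0.
apply/rowP => i; rewrite mxE; apply/eqP; rewrite -sqrf_eq0 expr2.
by apply: v0; rewrite mem_index_enum.
Qed.

Lemma l2norm_ge0 v : 0 <= l2norm v.
Proof. exact: sqrtr_ge0. Qed.

Lemma sqr_l2norm v : l2norm v ^+ 2 = dotprod v v.
Proof. by rewrite sqr_sqrtr// dotprod_ge0. Qed.

Lemma l2norm0 : l2norm (0 : 'rV[R]_n) = 0.
Proof. by rewrite /l2norm dotprod0l sqrtr0. Qed.

Lemma l2normZ a v : l2norm (a *: v) = `|a| * l2norm v.
Proof.
by rewrite /l2norm !dotprodE mulrA -expr2 sqrtrM ?sqr_ge0// sqrtr_sqr.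
Qed.

(** The squared length of [dotprod v v *: u - dotprod u v *: v] is nonnegative and equals
    [dotprod v v] times the difference of the two sides. *)
Lemma CauchySchwarz_dotprod u v :
  dotprod u v ^+ 2 <= dotprod u u * dotprod v v.
Proof.
have [v0|v_gt0] := eqVneq (dotprod v v) 0.
  by rewrite (dotprod_eq0 v0) dotprodC !dotprod0l expr0n mulr0.
have {}v_gt0 : 0 < dotprod v v by rewrite lt_def v_gt0 dotprod_ge0.
have := dotprod_ge0 (dotprod v v *: u - dotprod u v *: v).
rewrite !dotprodE (dotprodC v u) => h.
rewrite -subr_ge0 -(pmulr_rge0 _ v_gt0); apply: le_trans h _.
by rewrite le_eqVlt; apply/orP; left; apply/eqP; ring.
Qed.

Lemma ler_dotprod_l2norm u v : dotprod u v <= l2norm u * l2norm v.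
Proof.
rewrite /l2norm -sqrtrM ?dotprod_ge0//; apply: le_trans (ler_norm _) _.
rewrite -sqrtr_sqr ler_sqrt ?CauchySchwarz_dotprod//.
by rewrite mulr_ge0// dotprod_ge0.
Qed.

Lemma ler_coord_l2norm v i : `|v 0 i| <= l2norm v.
Proof.
rewrite -sqrtr_sqr ler_sqrt ?dotprod_ge0// /dotprod (bigD1 i)//= expr2 lerDl.
by apply: sumr_ge0 => j _; rewrite -expr2 sqr_ge0.
Qed.

(** Carries bounds on Euclidean length over to the sup norm, in which convergence of the iterates is
    established. *)
Lemma mx_norm_le_l2norm v : `|v| <= l2norm v.
Proof.
rewrite [leLHS]/Num.Def.normr/= mx_normrE (bigmax_le _ (l2norm_ge0 v))//=.
by move=> [i j] _ /=; rewrite ord1 ler_coord_l2norm.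
Qed.

(** Makes the supremum in [mx_l2norm] a genuine upper bound. On the unit ball every coordinate of
    [v] has absolute value at most 1, so coordinate [j] of [v *m A] is bounded by [M j]. *)
Lemma has_sup_l2norm_mulmx A :
  has_sup [set l2norm (v *m A) | v in [set v | l2norm v <= 1]].
Proof.
split; first by exists (l2norm (0 *m A)), 0 => //=; rewrite l2norm0 ler01.
pose M j := \sum_i `|A i j|.
exists (Num.sqrt (\sum_j M j ^+ 2)) => _ [v /= v1 <-].
rewrite ler_sqrt; last by apply: sumr_ge0 => j _; rewrite sqr_ge0.
apply: ler_sum => j _; rewrite -expr2 -real_normK ?num_real// lerXn2r ?nnegrE//.
  exact: sumr_ge0.
rewrite mxE; apply: le_trans (ler_norm_sum _ _ _) _; apply: ler_sum => i _.
by rewrite normrM ler_piMl// (le_trans (ler_coord_l2norm v i)).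
Qed.

Lemma l2norm_mulmx_le A v : l2norm (v *m A) <= mx_l2norm A * l2norm v.
Proof.
have [v0|v_gt0] := eqVneq (l2norm v) 0.
  have -> : v = 0 by apply: dotprod_eq0; rewrite -sqr_l2norm v0 expr0n.
  by rewrite mul0mx l2norm0 mulr0.
have {}v_gt0 : 0 < l2norm v by rewrite lt_def v_gt0 l2norm_ge0.
rewrite -ler_pdivrMr// mulrC -[X in X * _]ger0_norm ?invr_ge0 ?l2norm_ge0//.
rewrite -l2normZ scalemxAl; apply: ub_le_sup.
  by have [] := has_sup_l2norm_mulmx A.
exists ((l2norm v)^-1 *: v) => //=.
by rewrite l2normZ ger0_norm ?invr_ge0 ?l2norm_ge0// mulVf// gt_eqF.
Qed.

Lemma dotprod_mulmx_le A v :
  dotprod (v *m A) v <= mx_l2norm A * dotprod v v.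
Proof.
apply: le_trans (ler_dotprod_l2norm _ _) _; rewrite -sqr_l2norm expr2 mulrA.
by rewrite ler_wpM2r ?l2norm_ge0// l2norm_mulmx_le.
Qed.

End EuclideanSpace.

(** * Derivatives along a line *)

Section DirectionalDerivative.
Variables (R : realType) (n : nat).
Implicit Types (f : 'rV[R]_n -> R) (x v : 'rV[R]_n).

Lemma derive_gradient f x v :
  differentiable f x -> 'D_v f x = dotprod (gradient f x) v.
Proof.
move=> df; rewrite deriveE// [in LHS](row_sum_delta v) linear_sum.
by apply: eq_bigr => i _; rewrite linearZ/= mxE deriveE// mulrC.
Qed.

(** The difference quotient at [t] of the restriction to the line is the one of [F] at [x + t *: v]
    in direction [v]. *)
Lemma is_derive_line (W : normedModType R) (F : 'rV[R]_n -> W) x v t dF :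
  is_derive (x + t *: v) v F dF -> is_derive t 1 (fun s => F (x + s *: v)) dF.
Proof.
case=> + <-; rewrite /derive /derivable.
have -> : (fun h => h^-1 *: ((F \o shift (x + t *: v)) (h *: v) - F (x + t *: v)))
  = (fun h : R => h^-1 *: (((fun s => F (x + s *: v)) \o shift t) h%:A
                         - F (x + t *: v))).
  apply/funext => h /=; congr (_ *: (F _ - _)).
  by rewrite [_%:A]mulr1 addrCA scalerDl.
by move=> ?; apply: DeriveDef.
Qed.

Lemma is_derive_gradient_line f x v t :
  differentiable f (x + t *: v) ->
  is_derive t 1 (fun s => f (x + s *: v)) (dotprod (gradient f (x + t *: v)) v).
Proof.
move=> df; apply: is_derive_line; rewrite -derive_gradient//.
exact/derivableP/diff_derivable.
Qed.

Lemma is_derive_dotprod_line (G : 'rV[R]_n -> 'rV[R]_n) x v t :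
  differentiable G (x + t *: v) ->
  is_derive t 1 (fun s => dotprod (G (x + s *: v)) v)
            (dotprod (v *m 'J G (x + t *: v)) v).
Proof.
move=> dG; pose H i y := v 0 i *: G y 0 i.
have -> : (fun s => dotprod (G (x + s *: v)) v) =
          (fun s => (\sum_i H i) (x + s *: v)).
  by apply/funext => s; rewrite fct_sumE; apply: eq_bigr => i _; rewrite mulrC.
apply: is_derive_line; set y := x + t *: v in dG *.
have dGv : derivable G y v by exact: diff_derivable.
rewrite -deriveEjacobian// derive_mx//.
have -> : dotprod (\matrix_(i, j) 'D_v (fun z => G z i j) y) v =
          \sum_i v 0 i *: 'D_v (fun z => G z 0 i) y.
  by apply: eq_bigr => i _; rewrite mxE mulrC.
apply: is_derive_sum => i; apply: is_deriveZ.
by apply: derivableP; exact: (derivable_mxP G y v).1.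
Qed.

End DirectionalDerivative.

(** * Consequences of L-smoothness *)

Section Smoothness.
Variables (R : realType) (n : nat) (f : 'rV[R]_n -> R) (L : R).
Implicit Types (x v : 'rV[R]_n).

(* Only twice differentiability is available, so the usual integral remainder is
   replaced by monotonicity, applied first to the derivative and then to the
   function along the segment. *)
Lemma descent_lemma x v : smooth f L ->
  f (x + v) <= f x + dotprod (gradient f x) v + L / 2 * dotprod v v.
Proof.
case=> _ [df d2f] fL.
have mono (g dg : R -> R) : (forall t, is_derive t (1 : R) g (dg t)) ->
    (forall t, 0 <= t -> dg t <= 0) -> forall t, 0 <= t -> g t <= g 0.
  move=> gdg dg_le0 t t_ge0.
  have gd s : derivable g s 1 by case: (gdg s).
  have cg : {within `[0, t], continuous g}.
    by apply: derivable_within_continuous.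
  have g'_le0 s : s \in `]0, t[%R -> derive1 g s <= 0.
    rewrite in_itv/= => /andP[s0 _].
    by rewrite derive1E (derive_val (is_derive := gdg s)) dg_le0// ltW.
  by apply: (ler0_derive1_le_cc _ g'_le0 cg); rewrite ?in_itv/= ?lexx ?t_ge0.
pose q := dotprod v v; pose p := dotprod (gradient f x) v.
(* The Hessian bound makes the derivative of [g1] nonpositive. The derivative of [g0] is [g1 t - p],
   and [g1 0 = p], so [g0] is nonincreasing too; [g0 1 <= g0 0] is the claim. *)
pose g1 t := dotprod (gradient f (x + t *: v)) v - (L * q) * t.
pose g0 t := f (x + t *: v) - p * t - (L * q / 2) * t ^+ 2.
have g1_le t : 0 <= t -> g1 t <= g1 0.
  apply: (@mono g1 (fun t => dotprod (v *m hessian f (x + t *: v)) v - L * q)).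
    move=> s.
    have d1 : is_derive s (1 : R) g1
        (dotprod (v *m hessian f (x + s *: v)) v - (L * q) * 1).
      have h1 := is_derive_dotprod_line (d2f (x + s *: v)).
      have h2 := is_deriveZ (L * q) (is_derive_id s (1 : R)).
      exact: is_deriveB h1 h2.
    by rewrite mulr1 in d1.
  move=> s _; rewrite subr_le0; apply: le_trans (dotprod_mulmx_le _ _) _.
  by rewrite ler_wpM2r ?dotprod_ge0.
have g0_le : g0 1 <= g0 0.
  apply: (@mono g0 (fun t => g1 t - p)) => // [t|t t_ge0].
    have d0 : is_derive t (1 : R) g0 (dotprod (gradient f (x + t *: v)) v
        - p * 1 - (L * q / 2) * (2%:R * t ^+ 1 * 1)).
      have h1 := is_derive_gradient_line (df (x + t *: v)).
      have h2 := is_deriveZ p (is_derive_id t (1 : R)).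
      have h3 := is_deriveZ (L * q / 2) (is_deriveX 2 (is_derive_id t (1 : R))).
      exact: is_deriveB (is_deriveB h1 h2) h3.
    by apply: is_derive_eq d0 _; rewrite /g1; field.
  rewrite subr_le0; apply: le_trans (g1_le t t_ge0) _.
  by rewrite /g1 scale0r addr0 mulr0 subr0.
move: g0_le; rewrite /g0 scale1r scale0r addr0 /p /q; lra.
Qed.

(** By the descent lemma a gradient step of size [1 / L] would lower [f] by at least the squared
    gradient norm over [2 * L]. *)
Lemma minimizer_gradient0 x : smooth f L -> minimizer f x -> gradient f x = 0.
Proof.
move=> fL xmin; have L_gt0 : 0 < L by case: fL.
apply: dotprod_eq0; apply/eqP; rewrite eq_le dotprod_ge0 andbT.
have := descent_lemma x (- (L^-1 *: gradient f x)) fL.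
have := xmin (x - L^-1 *: gradient f x).
rewrite !dotprodE; set G := dotprod _ _ => fx fd.
have : 0 <= - (L^-1 * G) + L / 2 * (L^-1 * (L^-1 * G)).
  by rewrite -(lerD2l (f x)) addr0 addrA; move: fx fd; rewrite opprK; lra.
have -> : - (L^-1 * G) + L / 2 * (L^-1 * (L^-1 * G)) = - ((2 * L)^-1 * G).
  by field; rewrite gt_eqF.
by rewrite oppr_ge0 pmulr_rle0// invr_gt0 mulr_gt0.
Qed.

End Smoothness.

(** * The tangent inequality for convex functions *)

Section Convexity.
Variables (R : realType) (n : nat) (f : 'rV[R]_n -> R).
Implicit Types (x v : 'rV[R]_n).

Lemma convex_gradient_le x v : differentiable f x -> convex f ->
  f x + dotprod (gradient f x) v <= f (x + v).
Proof.
move=> df fconv; rewrite -derive_gradient// -lerBrDl.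
have fd : derivable f x v by exact: diff_derivable.
(* Convexity bounds the difference quotient by [f (x + v) - f x] only for [t] in (0, 1], hence the
   passage to the right-hand limit. *)
rewrite /derive cvg_at_rightE//; apply: limr_le.
  by apply/cvg_ex; eexists; apply: cvg_dnbhs_at_right; exact: fd.
near=> t.
have t0 : 0 < t by [].
have t1 : t <= 1 by near: t; exact: nbhs_right_le.
have /= := fconv (Itv01 (ltW t0) t1) (x + v) x.
rewrite !inE => /(_ I I).
rewrite convRE /conv/= /unstable.onem scalerDr addrAC -scalerDl subrKC scale1r.
rewrite [_ *: (f _ - _)]mulrC ler_pdivrMr// [t *: v + x]addrC; lra.
Unshelve. all: by end_near. Qed.

End Convexity.

(** * One gradient step under each assumption on [f] *)

Section GradientStep.
Variables (R : realType) (n : nat) (f : 'rV[R]_n -> R).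
Implicit Types (x : 'rV[R]_n) (a L mu alpha : R).

Lemma smooth_gradient_step x a L : smooth f L ->
  f (x - a *: gradient f x) <=
  f x - a * (1 - L * a / 2) * l2norm (gradient f x) ^+ 2.
Proof.
move=> fL; apply: le_trans (descent_lemma _ _ fL) _.
rewrite !dotprodE sqr_l2norm; lra.
Qed.

Lemma gradient_step_nonincreasing x a L : smooth f L -> 0 <= a <= 2 / L ->
  f (x - a *: gradient f x) <= f x.
Proof.
move=> fL /andP[a_ge0]; have L_gt0 : 0 < L by case: fL.
rewrite ler_pdivlMr// => aL; apply: le_trans (smooth_gradient_step _ _ fL) _.
by rewrite lerBlDr lerDl !mulr_ge0 ?l2norm_ge0//; lra.
Qed.

Lemma gradient_step_decrease x a L : smooth f L -> 0 <= a <= 1 / L ->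
  f (x - a *: gradient f x) <= f x - a / 2 * l2norm (gradient f x) ^+ 2.
Proof.
move=> fL /andP[a_ge0]; have L_gt0 : 0 < L by case: fL.
rewrite ler_pdivlMr// => aL; apply: le_trans (smooth_gradient_step _ _ fL) _.
by rewrite lerD2l lerN2 ler_wpM2r ?sqr_ge0// ler_wpM2l//; lra.
Qed.

Lemma inf_range_minimizer xs : minimizer f xs -> inf (range f) = f xs.
Proof.
move=> xsmin; apply/eqP; rewrite eq_le; apply/andP; split.
  by apply: ge_inf; [exists (f xs) => _ [x _ <-]; exact: xsmin | exists xs].
by apply: lb_le_inf; [exists (f xs), xs | move=> _ [x _ <-]; exact: xsmin].
Qed.

(** PL bounds the decrease below by [mu * a] times the gap, which gives the factor [1 - mu * a];
    then [1 + y <= expR y]. *)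
Lemma PL_gradient_step x xs a mu L :
  PL f mu -> smooth f L -> minimizer f xs -> 0 <= a <= 1 / L ->
  f (x - a *: gradient f x) - f xs <= expR (- (mu * a)) * (f x - f xs).
Proof.
move=> [mu_gt0 _ fPL] fL xsmin aL; have /andP[a_ge0 _] := aL.
have := fPL x; rewrite (inf_range_minimizer xsmin) => fPLx.
have : f (x - a *: gradient f x) - f xs <= (1 + - (mu * a)) * (f x - f xs).
  have := gradient_step_decrease x fL aL.
  have : a * (mu * (f x - f xs)) <= a * (1 / 2 * l2norm (gradient f x) ^+ 2).
    by rewrite ler_wpM2l.
  lra.
move=> /le_trans; apply; rewrite ler_wpM2r ?expR_ge1Dx// subr_ge0.
exact: xsmin.
Qed.

(** With [A], [B] the roots of the gap before and after the step, the decrease gives [a / 2 * S ^+ 2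
    <= A ^+ 2 - B ^+ 2 <= 2 * A * (A - B)]. PL reads [m * A <= S], so one factor [S] cancels;
    [S = 0] is treated apart. *)
Lemma PL_gradient_step_length x xs a mu L :
  PL f mu -> smooth f L -> minimizer f xs -> 0 <= a <= 1 / L ->
  a * l2norm (gradient f x) <=
  4 / Num.sqrt (2 * mu) *
    (Num.sqrt (f x - f xs) - Num.sqrt (f (x - a *: gradient f x) - f xs)).
Proof.
move=> [mu_gt0 _ fPL] fL xsmin aL; have /andP[a_ge0 _] := aL.
have := gradient_step_decrease x fL aL.
have := fPL x; rewrite (inf_range_minimizer xsmin).
set S := l2norm _; set y := x - _.
have S_ge0 : 0 <= S by exact: l2norm_ge0.
have m_gt0 : 0 < Num.sqrt (2 * mu) by rewrite sqrtr_gt0 mulr_gt0.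
have : Num.sqrt (2 * mu) ^+ 2 = 2 * mu by rewrite sqr_sqrtr// mulr_ge0// ltW.
have : Num.sqrt (f x - f xs) ^+ 2 = f x - f xs.
  by rewrite sqr_sqrtr// subr_ge0; exact: xsmin.
have : Num.sqrt (f y - f xs) ^+ 2 = f y - f xs.
  by rewrite sqr_sqrtr// subr_ge0; exact: xsmin.
have := sqrtr_ge0 (f x - f xs); have := sqrtr_ge0 (f y - f xs).
move: m_gt0; set m := Num.sqrt (2 * mu).
set A := Num.sqrt (f x - f xs); set B := Num.sqrt (f y - f xs).
move=> m_gt0 B_ge0 A_ge0 B2 A2 m2 fPLx dec.
have mA_le_S : m * A <= S.
  rewrite -(@ler_pXn2r _ 2%N)// ?nnegrE ?mulr_ge0 ?(ltW m_gt0)//.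
  by rewrite exprMn A2 m2; lra.
have B_le_A : B <= A.
  rewrite -(@ler_pXn2r _ 2%N)// ?nnegrE// A2 B2.
  have : 0 <= a / 2 * S ^+ 2 by rewrite !mulr_ge0 ?sqr_ge0.
  lra.
rewrite mulrAC ler_pdivlMr//.
have [S0|S_neq0] := eqVneq S 0; first by rewrite S0 mulr0 mul0r; lra.
rewrite -(ler_pM2r (_ : 0 < S)); last by rewrite lt_def S_neq0.
have : a * S ^+ 2 * m <= 4 * A * (A - B) * m.
  rewrite ler_pM2r//.
  have : B * (A - B) <= A * (A - B) by rewrite ler_wpM2r// subr_ge0.
  rewrite !expr2 in B2 A2 *; lra.
have : m * A * (A - B) <= S * (A - B) by rewrite ler_wpM2r// subr_ge0.
rewrite expr2; lra.
Qed.

(** The tangent inequality at [x] and the decrease bound the new gap by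
    [dotprod g d - a / 2 * dotprod g g], where [d = x - xs]; times [2 * a], this is exactly the drop
    of the squared distance. *)
Lemma convex_gradient_step x xs a L :
  convex f -> smooth f L -> 0 <= a <= 1 / L ->
  2 * a * (f (x - a *: gradient f x) - f xs) <=
  l2norm (x - xs) ^+ 2 - l2norm (x - a *: gradient f x - xs) ^+ 2.
Proof.
move=> fconv fL aL; have /andP[a_ge0 _] := aL.
have df : differentiable f x by case: fL => _ [].
have := convex_gradient_le (xs - x) df fconv; rewrite subrKC.
have := gradient_step_decrease x fL aL.
rewrite [x - _ - xs]addrAC -(opprB x) !sqr_l2norm.
move: (x - xs) (gradient f x) (f (x - _)) => d g fy.
rewrite !dotprodE (dotprodC d g) => dec conv.
have : a * (fy - f xs) <= a * (dotprod g d - a / 2 * dotprod g g).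
  by rewrite ler_wpM2l//; lra.
lra.
Qed.

(** This is cocoercivity of the gradient of [f - alpha/2 |.|^2], with constant [L - alpha], between
    [x] and [xs]; [D] is the difference of its gradients there. *)
Lemma strongly_convex_cocoercive x xs alpha L :
  strongly_convex f alpha -> smooth f L -> minimizer f xs -> alpha <= L ->
  l2norm (gradient f x) ^+ 2 + alpha * L * l2norm (x - xs) ^+ 2 <=
  (L + alpha) * dotprod (gradient f x) (x - xs).
Proof.
move=> [_ sc] fL xsmin aL; have grad0 := minimizer_gradient0 fL xsmin.
pose D := gradient f x - alpha *: (x - xs).
(* The tangent inequalities of [f - alpha/2 |.|^2] at [xs] and [x], tested at
   the points [x - s D] and [xs + s D]. *)
have key s : (2 * s - (L - alpha) * s ^+ 2) * dotprod D D <=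
    dotprod (gradient f x) (x - xs) - alpha * dotprod (x - xs) (x - xs).
  have := sc (x - s *: D) xs; have := descent_lemma x (- (s *: D)) fL.
  have := sc (xs + s *: D) x; have := descent_lemma xs (s *: D) fL.
  have -> : xs + s *: D - x = s *: D - (x - xs) by rewrite opprB addrCA addrA.
  rewrite [x - _ - xs]addrAC grad0 !dotprod0l !sqr_l2norm.
  have : dotprod D D = dotprod (gradient f x) D - alpha * dotprod (x - xs) D.
    by rewrite -dotprodZl -dotprodNl -dotprodDl.
  move: (f (xs + s *: D)) (f (x - s *: D)) => u w; clearbody D.
  move: (x - xs) (gradient f x) => d g.
  rewrite !dotprodE (dotprodC D d) => DD h1 h2 h3 h4.
  have : s * dotprod D D = s * (dotprod g D - alpha * dotprod d D).
    by rewrite -DD.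
  lra.
have DE : dotprod D D =
    dotprod (gradient f x) (gradient f x)
    - 2 * alpha * dotprod (gradient f x) (x - xs)
    + alpha ^+ 2 * dotprod (x - xs) (x - xs).
  rewrite /D; move: (x - xs) (gradient f x) => d g.
  by rewrite !dotprodE (dotprodC d g); ring.
rewrite !sqr_l2norm; clearbody D.
move: (x - xs) (gradient f x) key DE => d g key DE.
suff : dotprod D D <= (L - alpha) * (dotprod g d - alpha * dotprod d d).
  by rewrite DE; lra.
(* For [alpha < L] the coefficient in [key] is largest at [s = 1 / (L - alpha)]. For [L = alpha] it
   is [2 * s], unbounded in [s], which forces [D] to vanish. *)
have [Lalpha|L_neq_alpha] := eqVneq L alpha; last first.
  have M_gt0 : 0 < L - alpha by rewrite subr_gt0 lt_def L_neq_alpha.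
  have := key (L - alpha)^-1; rewrite -(ler_pM2l M_gt0) mulrA.
  rewrite (_ : _ * (_ - _) = 1) ?mul1r//.
  by field; rewrite gt_eqF.
rewrite Lalpha subrr mul0r leNgt; apply/negP => D_gt0.
(* This [s] turns [key] into [K + 1 <= K]. *)
have := key ((dotprod g d - alpha * dotprod d d + 1) / (2 * dotprod D D)).
rewrite Lalpha subrr mul0r subr0.
set K := dotprod g d - _.
rewrite (_ : _ * _ = K + 1); first by rewrite gerDl ler10.
by field; rewrite gt_eqF.
Qed.

(** In the expanded squared distance, cocoercivity trades the cross term [P] for [G] and [Q]. The
    step bound makes the resulting coefficient of [G] nonpositive, so [G >= alpha ^+ 2 * Q] leaves
    the factor [(1 - alpha * a) ^+ 2]. *)
Lemma strongly_convex_gradient_step x xs a alpha L :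
  strongly_convex f alpha -> smooth f L -> minimizer f xs ->
  0 <= a <= 2 / (alpha + L) ->
  l2norm (x - a *: gradient f x - xs) <=
  expR (- (alpha * a)) * l2norm (x - xs).
Proof.
move=> fsc fL xsmin /andP[a_ge0].
have [alpha_gt0 sc] := fsc; have L_gt0 : 0 < L by case: fL.
have aL_gt0 : 0 < alpha + L by rewrite addr_gt0.
rewrite ler_pdivlMr// => aL.
have grad0 := minimizer_gradient0 fL xsmin.
(* [alpha <= L] comes from comparing the quadratic bounds at [xs] in a nonzero direction; in
   dimension 0 it may fail. *)
have [d0|d_neq0] := eqVneq (dotprod (x - xs) (x - xs)) 0.
  move/dotprod_eq0/eqP: d0; rewrite subr_eq0 => /eqP ->.
  by rewrite grad0 scaler0 subr0 subrr l2norm0 mulr0.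
have d_gt0 : 0 < dotprod (x - xs) (x - xs) by rewrite lt_def d_neq0 dotprod_ge0.
have alpha_le_L : alpha <= L.
  have := descent_lemma xs (x - xs) fL; have := sc x xs.
  rewrite subrKC grad0 dotprod0l sqr_l2norm => h1 h2.
  have : alpha / 2 * dotprod (x - xs) (x - xs) <=
         L / 2 * dotprod (x - xs) (x - xs) by lra.
  by rewrite ler_pM2r//; lra.
have := strongly_convex_cocoercive x fsc fL xsmin alpha_le_L.
have := dotprod_ge0 (gradient f x - alpha *: (x - xs)).
have : alpha * dotprod (x - xs) (x - xs) <= dotprod (gradient f x) (x - xs).
  have := sc x xs; have := sc xs x.
  rewrite grad0 dotprod0l -(opprB x xs) !sqr_l2norm !dotprodE; lra.
rewrite addrAC; move: (x - xs) (gradient f x) d_neq0 d_gt0 => d g d_neq0 d_gt0.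
rewrite !sqr_l2norm !dotprodE (dotprodC d g).
set G := dotprod g g; set P := dotprod g d; set Q := dotprod d d => PQ GPQ coco.
have GQ : alpha ^+ 2 * Q <= G.
  have : alpha * (alpha * Q) <= alpha * P by rewrite ler_wpM2l// ltW.
  rewrite expr2; lra.
(* The sign allows the comparison of norms to be made on squares. *)
have a1 : 0 <= 1 - alpha * a.
  have : a * alpha <= a * L by rewrite ler_wpM2l.
  lra.
apply: (@le_trans _ _ ((1 + - (alpha * a)) * l2norm d)); last first.
  by rewrite ler_wpM2r ?l2norm_ge0// expR_ge1Dx.
rewrite -(@ler_pXn2r _ 2%N)// ?nnegrE ?mulr_ge0 ?l2norm_ge0//.
rewrite exprMn !sqr_l2norm !dotprodE (dotprodC d g) -/G -/P -/Q.
rewrite -(ler_pM2l aL_gt0).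
have : a * ((L + alpha) * P) >= a * (G + alpha * L * Q) by rewrite ler_wpM2l.
have : 0 <= a * (2 - a * (alpha + L)) * (G - alpha ^+ 2 * Q).
  by rewrite !mulr_ge0// subr_ge0.
rewrite !expr2; lra.
Qed.

End GradientStep.

(** * Chain rule for the shifted root, iterated contraction, and curves of finite length *)

Lemma gradient_sqrt_shift (R : realType) (n : nat) (f : 'rV[R]_n -> R) (c : R)
    (x : 'rV[R]_n) : differentiable f x -> 0 < f x + c ->
  gradient (sqrt_shift f c) x = (2 * sqrt_shift f c x)^-1 *: gradient f x.
Proof.
move=> df fc; pose h := f + cst c.
have dh : differentiable h x by apply: differentiableD.
have ds : is_derive (h x) 1 Num.sqrt (2 * Num.sqrt (h x))^-1.
  exact: is_derive1_sqrt.
have [sqrt1 sqrtE] := ds.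
have dsqrt : differentiable (Num.sqrt : R -> R) (h x) by apply/derivable1_diffP.
have -> : sqrt_shift f c = Num.sqrt \o h by [].
apply/rowP => i; rewrite !mxE deriveE; last exact: differentiable_comp.
rewrite diff_comp//= deriv1E// derive1E sqrtE diffD//.
rewrite diff_cst/= addr0.
by rewrite -deriveE// [_ *: _]mulrC.
Qed.

(** Contraction is asked only between [k0] and [k], because the rate [b] will contain [r k] and so
    depend on the final index. *)
Lemma ler_geometric_chain (R : realType) (w : nat -> R) (b : R) (k0 k : nat) :
  (k0 <= k)%N ->
  (forall j, (k0 <= j < k)%N -> w j.+1 <= expR (- b) * w j) ->
  w k <= expR (- b * (k - k0)%:R) * w k0.
Proof.
elim: k => [|k IH].
  by rewrite leqn0 => /eqP -> _; rewrite subnn mulr0 expR0 mul1r.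
rewrite leq_eqVlt => /predU1P[-> _|]; first by rewrite subnn mulr0 expR0 mul1r.
rewrite ltnS => k0k wS; have := wS k; rewrite k0k ltnSn => /(_ isT) /le_trans.
apply; rewrite subSn// -natr1 mulrDr mulr1 addrC expRD -mulrA.
rewrite ler_wpM2l ?expR_ge0// IH// => j /andP[k0j jk].
by apply: wS; rewrite k0j ltnW.
Qed.

(* 'M[R]_(m, n) is both complete and normed, but the library does not declare
   the join of the two structures. *)
HB.instance Definition _ (R : realType) (m n : nat) := Complete.on 'M[R]_(m, n).

Lemma cvgn_finite_length (R : realType) (n k0 : nat) (u : nat -> 'rV[R]_n)
    (M : R) :
  (forall k, \sum_(k0 <= j < k) l2norm (u j.+1 - u j) <= M) -> cvgn u.
Proof.
move=> uM; pose v := telescope u.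
suff cv : cvgn (series v).
  have -> : u = (fun k => u 0%N + series v k).
    by apply/funext => k; rewrite -eq_sum_telescope.
  exact: is_cvgD (is_cvg_cst _) cv.
apply: normed_cvg; apply: nondecreasing_is_cvgn.
  by apply: nondecreasing_series => k _ _ /=.
(* [M] controls only the increments from [k0] on; the earlier ones are added. Extending the sum to
   [maxn k0 k] covers [k < k0]. *)
exists (\sum_(0 <= j < k0) l2norm (u j.+1 - u j) + M) => _ [k _ <-].
apply: (@le_trans _ _ (\sum_(0 <= j < k) l2norm (u j.+1 - u j))).
  by apply: ler_sum => j _; exact: mx_norm_le_l2norm.
apply: (@le_trans _ _ (\sum_(0 <= j < maxn k0 k) l2norm (u j.+1 - u j))).
  rewrite [leRHS](big_cat_nat _ (leq_maxr k0 k))//= lerDl.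
  by apply: sumr_ge0 => j _; exact: l2norm_ge0.
by rewrite (big_cat_nat _ (leq_maxl k0 k))//= lerD2l.
Qed.

(** * The AEGD iteration and its rates *)

Section AEGDIteration.
Variables (R : realType) (n : nat) (f : 'rV[R]_n -> R) (c eta : R).
Variables (theta0 : 'rV[R]_n) (theta : nat -> 'rV[R]_n) (r : nat -> R).
Hypothesis f_diff : forall x, differentiable f x.
Hypothesis fc_gt0 : forall x, 0 < f x + c.
Hypothesis eta_gt0 : 0 < eta.
Hypothesis aegd : AEGD f c eta theta0 theta r.

Local Notation g := (sqrt_shift f c).
Local Notation step := (eff_step f c eta theta r).

Lemma AEGD_denom_ge1 k : 1 <= 1 + 2 * eta * l2norm (gradient g (theta k)) ^+ 2.
Proof. by rewrite lerDl !mulr_ge0 ?l2norm_ge0// ltW. Qed.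

Lemma AEGD_r_gt0 k : 0 < r k.
Proof.
case: aegd => _ r0 rS _; elim: k => [|k IH]; first by rewrite r0 sqrtr_gt0.
by rewrite rS divr_gt0// (lt_le_trans ltr01)// AEGD_denom_ge1.
Qed.

Lemma AEGD_r_drop k :
  2 * eta * r k.+1 * l2norm (gradient g (theta k)) ^+ 2 = r k - r k.+1.
Proof.
case: aegd => _ _ rS _; rewrite rS; field.
by rewrite gt_eqF// (lt_le_trans ltr01)// AEGD_denom_ge1.
Qed.

Lemma AEGD_r_nonincreasing : {homo r : i j / (i <= j)%N >-> j <= i}.
Proof.
apply: homo_leq => [x|x y z|k]; rewrite ?lexx//.
  by move=> yx zy; exact: le_trans zy yx.
rewrite -subr_ge0 -AEGD_r_drop !mulr_ge0 ?l2norm_ge0 ?(ltW (AEGD_r_gt0 _))//.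
exact: ltW.
Qed.

(** Monotonicity allows [r k] to be replaced by [r j.+1] in each term; the sum then telescopes to
    [r 0 - r k]. *)
Lemma AEGD_sum_gradient k :
  2 * eta * r k * \sum_(0 <= j < k) l2norm (gradient g (theta j)) ^+ 2 <= r 0.
Proof.
rewrite mulr_sumr; apply: (@le_trans _ _ (\sum_(0 <= j < k) (r j - r j.+1))).
  rewrite !big_nat; apply: ler_sum => j /andP[_ jk]; rewrite -AEGD_r_drop.
  rewrite ler_wpM2r ?sqr_ge0// ler_pM2l ?mulr_gt0//.
  exact: AEGD_r_nonincreasing.
under eq_bigr do rewrite -opprB.
rewrite sumrN telescope_sumr// opprB lerBlDr lerDl ltW//.
exact: AEGD_r_gt0.
Qed.

Lemma sqrt_shift_gt0 x : 0 < g x.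
Proof. by rewrite sqrtr_gt0. Qed.

Lemma AEGD_gradient_step k :
  theta k.+1 = theta k - step k *: gradient f (theta k).
Proof.
case: aegd => _ _ _ ->; rewrite gradient_sqrt_shift// scalerA /eff_step.
congr (_ - _ *: _); field; by rewrite gt_eqF// sqrt_shift_gt0.
Qed.

Lemma eff_step_gt0 k : 0 < step k.
Proof. by rewrite divr_gt0 ?mulr_gt0 ?AEGD_r_gt0// sqrt_shift_gt0. Qed.

Lemma eff_step_le k0 k b : max_eff_step f c eta theta r k0 k <= b ->
  forall j, (k0 <= j < k)%N -> 0 <= step j <= b.
Proof.
move=> maxb j jk; rewrite ltW ?eff_step_gt0//=; apply: le_trans maxb.
by apply: le_bigmax_seq; rewrite ?mem_index_iota.
Qed.

Lemma AEGD_nonincreasing L k0 k : smooth f L ->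
  (forall j, (k0 <= j < k)%N -> 0 <= step j <= 2 / L) ->
  forall i j, (k0 <= i <= j)%N -> (j <= k)%N -> f (theta j) <= f (theta i).
Proof.
move=> fL stepL i; elim=> [|j IH]; first by rewrite leqn0 => /andP[_ /eqP->].
move=> /andP[k0i]; rewrite leq_eqVlt => /predU1P[-> //|ij] jk.
apply: le_trans (IH _ (ltnW jk)); last by rewrite k0i.
rewrite AEGD_gradient_step (gradient_step_nonincreasing _ fL)// stepL//.
by rewrite jk (leq_trans k0i).
Qed.

Lemma eff_step_ge L k0 k : smooth f L ->
  (forall j, (k0 <= j < k)%N -> 0 <= step j <= 2 / L) ->
  forall j, (k0 <= j < k)%N ->
  eta * r k / Num.sqrt (f (theta k0) + c) <= step j.
Proof.
move=> fL stepL j /andP[k0j jk]; apply: ler_pM.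
- by rewrite mulr_ge0 ?(ltW (AEGD_r_gt0 _))// ltW.
- by rewrite invr_ge0 sqrtr_ge0.
- by rewrite ler_pM2l//; exact: AEGD_r_nonincreasing.
rewrite lef_pV2 ?posrE ?sqrtr_gt0// ler_sqrt ?(ltW (fc_gt0 _))// lerD2r.
by apply: (AEGD_nonincreasing fL stepL); rewrite ?leqnn ?k0j// ltnW.
Qed.

Lemma step_le_inv_le k0 k L : smooth f L ->
  (forall j, (k0 <= j < k)%N -> 0 <= step j <= 1 / L) ->
  forall j, (k0 <= j < k)%N -> 0 <= step j <= 2 / L.
Proof.
move=> [L_gt0 _ _] stepL j /stepL /andP[-> /le_trans]; apply.
by rewrite ler_pM2r ?invr_gt0// ler1n.
Qed.

Lemma AEGD_PL_rate mu L thetas k0 k :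
  PL f mu -> smooth f L -> minimizer f thetas -> (k0 < k)%N ->
  max_eff_step f c eta theta r k0 k <= 1 / L ->
  f (theta k) - f thetas <=
  expR (- (mu * eta / Num.sqrt (f (theta k0) + c)) * (k - k0)%:R * r k)
  * (f (theta k0) - f thetas).
Proof.
move=> fPL fL tmin k0k maxL; have stepL := eff_step_le maxL.
have mu_gt0 : 0 < mu by case: fPL.
(* Groups [r k] with the constant, so that the rate per step is the same for all [j]. *)
rewrite mulrAC mulNr.
apply: (@ler_geometric_chain _ (fun j => f (theta j) - f thetas) (_ * r k) _ _
          (ltnW k0k)).
move=> j jk; rewrite AEGD_gradient_step.
apply: le_trans (PL_gradient_step _ fPL fL tmin (stepL _ jk)) _.
rewrite ler_wpM2r ?subr_ge0//.
rewrite ler_expR lerN2 mulrAC -!mulrA ler_pM2l// mulrA.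
exact: (eff_step_ge fL (step_le_inv_le fL stepL)).
Qed.

Lemma AEGD_PL_length mu L thetas k0 k :
  PL f mu -> smooth f L -> minimizer f thetas ->
  (forall j, (k0 <= j < k)%N -> 0 <= step j <= 1 / L) ->
  \sum_(k0 <= j < k) l2norm (theta j.+1 - theta j) <=
  4 / Num.sqrt (2 * mu) * Num.sqrt (f (theta k0) - f thetas).
Proof.
move=> fPL fL tmin stepL.
have C_ge0 : 0 <= 4 / Num.sqrt (2 * mu) by rewrite divr_ge0 ?sqrtr_ge0.
have [kk0|/ltnW k0k] := leqP k k0.
  by rewrite big_geq// mulr_ge0 ?sqrtr_ge0.
pose w j := Num.sqrt (f (theta j) - f thetas).
apply: (@le_trans _ _ (\sum_(k0 <= j < k)
    4 / Num.sqrt (2 * mu) * (- (w j.+1 - w j)))).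
  rewrite !big_nat; apply: ler_sum => j jk; rewrite opprB /w AEGD_gradient_step.
  apply: le_trans (PL_gradient_step_length _ fPL fL tmin (stepL _ jk)).
  rewrite addrC addKr -scaleNr l2normZ normrN ger0_norm//.
  by have /andP[] := stepL _ jk.
rewrite -mulr_sumr sumrN telescope_sumr// ler_wpM2l// opprB lerBlDr lerDl.
exact: sqrtr_ge0.
Qed.

(** Every step is at least [s] and every later gap at least the one at [k], so [k - k0] copies of
    [2 * s] times the last gap fit under the telescoping squared distances. *)
Lemma AEGD_convex_rate L thetas k0 k :
  convex f -> smooth f L -> minimizer f thetas -> (k0 < k)%N ->
  max_eff_step f c eta theta r k0 k <= 1 / L ->
  f (theta k) - f thetas <=
  Num.sqrt (f (theta k0) + c) / eta * l2norm (theta k0 - thetas) ^+ 2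
  / (2 * (k - k0)%:R * r k).
Proof.
move=> fconv fL tmin k0k maxL; have stepL := eff_step_le maxL.
have stepL2 := step_le_inv_le fL stepL.
pose D j := l2norm (theta j - thetas) ^+ 2.
set s := eta * r k / Num.sqrt (f (theta k0) + c).
have s_gt0 : 0 < s.
  by rewrite divr_gt0 ?mulr_gt0 ?AEGD_r_gt0// sqrtr_gt0.
have sum_le : \sum_(k0 <= j < k) 2 * s * (f (theta k) - f thetas) <= D k0.
  apply: (@le_trans _ _ (\sum_(k0 <= j < k) - (D j.+1 - D j))).
    rewrite !big_nat; apply: ler_sum => j jk; rewrite opprB /D.
    rewrite AEGD_gradient_step.
    apply: le_trans (convex_gradient_step _ _ fconv fL (stepL _ jk)).
    rewrite -AEGD_gradient_step -!(mulrA 2) ler_pM2l//; apply: ler_pM.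
    - exact: ltW.
    - by rewrite subr_ge0; exact: tmin.
    - exact: (eff_step_ge fL stepL2).
    rewrite lerD2r (AEGD_nonincreasing fL stepL2)// andbC.
    by case/andP: jk => k0j ->; rewrite leqW.
  rewrite sumrN telescope_sumr ?(ltnW k0k)// opprB lerBlDr lerDl.
  exact: sqr_ge0.
move: sum_le; rewrite sumr_const_nat -mulr_natr -/(D k0).
have kk0 : 0 < (k - k0)%:R :> R by rewrite ltr0n subn_gt0.
have q_gt0 : 0 < Num.sqrt (f (theta k0) + c) by rewrite sqrtr_gt0.
have rk := AEGD_r_gt0 k.
move=> sum_le; rewrite ler_pdivlMr ?mulr_gt0//.
rewrite -(ler_pM2l (_ : 0 < eta / Num.sqrt (f (theta k0) + c))) ?divr_gt0//.
rewrite [leRHS](_ : _ = D k0); last by field; rewrite !gt_eqF.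
apply: le_trans sum_le; rewrite le_eqVlt; apply/orP; left; apply/eqP.
by rewrite /s; field; rewrite gt_eqF.
Qed.

Lemma AEGD_strongly_convex_rate alpha L thetas k0 k :
  strongly_convex f alpha -> smooth f L -> minimizer f thetas -> (k0 < k)%N ->
  max_eff_step f c eta theta r k0 k <= 2 / (alpha + L) ->
  l2norm (theta k - thetas) <=
  expR (- (alpha * eta / Num.sqrt (f (theta k0) + c)) * (k - k0)%:R * r k)
  * l2norm (theta k0 - thetas).
Proof.
move=> fsc fL tmin k0k maxL; have stepL := eff_step_le maxL.
have alpha_gt0 : 0 < alpha by case: fsc.
have L_gt0 : 0 < L by case: fL.
(* [2 / (alpha + L) <= 2 / L], so [f] still decreases along the iterates and the lower bound on the
   steps applies. *)
have stepL2 j : (k0 <= j < k)%N -> 0 <= step j <= 2 / L.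
  move=> /stepL /andP[-> /le_trans]; apply.
  by rewrite ler_pM2l// lef_pV2 ?posrE ?addr_gt0// lerDr ltW.
rewrite mulrAC mulNr.
apply: (@ler_geometric_chain _ (fun j => l2norm (theta j - thetas)) (_ * r k) _ _
          (ltnW k0k)).
move=> j jk; rewrite AEGD_gradient_step.
apply: le_trans (strongly_convex_gradient_step _ fsc fL tmin (stepL _ jk)) _.
rewrite ler_wpM2r ?l2norm_ge0//.
rewrite ler_expR lerN2 mulrAC -!mulrA ler_pM2l// mulrA.
exact: (eff_step_ge fL stepL2).
Qed.

End AEGDIteration.

(** * Assembly of the estimates *)

Theorem theorem3p3 (R : realType) (n : nat) (f : 'rV[R]_n -> R) (c eta : R)
    (theta0 : 'rV[R]_n) (theta : nat -> 'rV[R]_n) (r : nat -> R)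
    (f_diff : forall x, differentiable f x)
    (f_bounded_below : has_lbound (range f))
    (fc_gt0 : forall x, 0 < f x + c)
    (eta_gt0 : 0 < eta)
    (aegd : AEGD f c eta theta0 theta r) :
  [/\ (forall k : nat, (1 <= k)%N ->
        1 / k%:R *
          \sum_(0 <= j < k) l2norm (gradient (sqrt_shift f c) (theta j)) ^+ 2
        <= Num.sqrt (f theta0 + c) / (2 * eta * k%:R * r k)),
      (* (i) *)
      (forall (mu L : R) (thetas : 'rV[R]_n) (k0 : nat),
        PL f mu -> smooth f L -> minimizer f thetas ->
        ((forall k : nat, (k0 < k)%N ->
            max_eff_step f c eta theta r k0 k <= 1 / L) ->
          cvgn theta /\
          (\sum_(k0 <= k <oo) (l2norm (theta k.+1 - theta k))%:E
           <= (4 / Num.sqrt (2 * mu) *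
                Num.sqrt (f (theta k0) - f thetas))%:E)%E) /\
        (let c0 := mu * eta / Num.sqrt (f (theta k0) + c) in
         forall k : nat, (k0 < k)%N ->
           max_eff_step f c eta theta r k0 k <= 1 / L ->
           f (theta k) - f thetas
           <= expR (- c0 * (k - k0)%:R * r k) * (f (theta k0) - f thetas))),
      (* (ii) *)
      (forall (L : R) (thetas : 'rV[R]_n),
        convex f -> smooth f L -> minimizer f thetas ->
        forall k0 k : nat, (k0 < k)%N ->
        max_eff_step f c eta theta r k0 k <= 1 / L ->
        let c1 := Num.sqrt (f (theta k0) + c) / eta in
        f (theta k) - f thetas
        <= c1 * l2norm (theta k0 - thetas) ^+ 2 / (2 * (k - k0)%:R * r k)) &
      (* (iii) *)
      (forall (alpha L : R) (thetas : 'rV[R]_n),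
        strongly_convex f alpha -> smooth f L -> minimizer f thetas ->
        forall k0 k : nat, (k0 < k)%N ->
        max_eff_step f c eta theta r k0 k <= 2 / (alpha + L) ->
        let c2 := alpha * eta / Num.sqrt (f (theta k0) + c) in
        l2norm (theta k - thetas)
        <= expR (- c2 * (k - k0)%:R * r k) * l2norm (theta k0 - thetas))].
Proof.
split.
- move=> k k_gt0; have [theta00 r0 _ _] := aegd.
  have rk := AEGD_r_gt0 fc_gt0 eta_gt0 aegd k.
  have k0 : 0 < k%:R :> R by rewrite ltr0n.
  rewrite ler_pdivlMr ?mulr_gt0// -r0.
  apply: le_trans (AEGD_sum_gradient fc_gt0 eta_gt0 aegd k).
  by rewrite le_eqVlt; apply/orP; left; apply/eqP; field; rewrite gt_eqF.
- move=> mu L thetas k0 fPL fL tmin; split=> [maxL|c0 k k0k maxL]; last first.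
    exact: (AEGD_PL_rate f_diff fc_gt0 eta_gt0 aegd fPL fL).
  have stepL k j : (k0 <= j < k)%N -> 0 <= eff_step f c eta theta r j <= 1 / L.
    move=> jk; apply: (eff_step_le fc_gt0 eta_gt0 aegd _ jk); apply: maxL.
    by case/andP: jk => k0j; exact: leq_ltn_trans.
  have length k := AEGD_PL_length f_diff fc_gt0 aegd fPL fL tmin (@stepL k).
  split; first exact: cvgn_finite_length length.
  (* Nonnegative terms give the series a limit in the extended reals, which inherits the uniform
     bound on the partial sums. *)
  apply: lime_le.
    by apply: is_cvg_nneseries => j _ _; rewrite lee_fin l2norm_ge0.
  by apply: nearW => k; rewrite sumEFin lee_fin.
- move=> L thetas fconv fL tmin k0 k k0k maxL.
  exact: (AEGD_convex_rate f_diff fc_gt0 eta_gt0 aegd fconv fL).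
- move=> alpha L thetas fsc fL tmin k0 k k0k maxL.
  exact: (AEGD_strongly_convex_rate f_diff fc_gt0 eta_gt0 aegd fsc fL).
Qed.
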